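(* Let $p>1$ and let $u\in C(\mathbb{R}^n\times[0,\infty))$ be such that $u$ is a viscosity solution of $\operatorname{div}(|Du|^{p-2}Du)=|Du|^{p-2}u_t$ in $\Omega\times[0,T]$ for every bounded open set $\Omega\subset\mathbb{R}^n$ and every $T>0$ (no a priori assumption that $u\in L^\infty(\mathbb{R}^n\times(0,\infty))$ is made). Assume further that for some $A,a>0$ $$u(x,t)\le Ae^{a|x|^2}\qquad\text{for every }(x,t)\in\mathbb{R}^n\times[0,\infty).$$ Then, for every $T>0$, $$\sup_{\mathbb{R}^n\times[0,T]}u=\sup_{x\in\mathbb{R}^n}u(x,0).$$
   Context: $D$ denotes the spatial gradient. Viscosity solutions. Let $p\ge1$, $\Omega\subset\mathbb{R}^n$ open, $0<T\le\infty$. A function $u\in C(\Omega\times[0,T))\cap L^\infty(\Omega\times[0,T))$ is a viscosity subsolution of $\operatorname{div}(|Du|^{p-2}Du)=|Du|^{p-2}u_t$ in $\Omega\times[0,T)$ if, whenever $\phi\in C^2(\Omega\times(0,T))$ and $u-\phi$ has a local maximum at $z_0\in\Omega\times(0,T)$, one has at $z_0$ (summing over repeated indices) $\phi_t\le\left(\delta_{ij}+(p-2)\frac{\phi_i\phi_j}{|D\phi|^2}\right)\phi_{ij}$ if $D\phi(z_0)\ne0$, and $\phi_t\le(\delta_{ij}+(p-2)a_ia_j)\phi_{ij}$ for some $a\in\mathbb{R}^n$ with $|a|\le1$ if $D\phi(z_0)=0$. A viscosity supersolution is defined with ''local minimum'' and the inequalities reversed ($\ge$). A viscosity solution is both a sub-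 and a supersolution. For $T<\infty$, a viscosity solution in $\Omega\times[0,T]$ means one in $\Omega\times[0,T+\varepsilon)$ for some $\varepsilon>0$. *)

(* Defs.v *)
From HB Require Import structures.
From mathcomp Require Import all_boot all_order all_algebra.
From mathcomp Require Import all_classical all_reals all_analysis.

Set Implicit Arguments.
Unset Strict Implicit.
Unset Printing Implicit Defensive.

Import Order.TTheory GRing.Theory Num.Theory.
Import numFieldNormedType.Exports.

Local Open Scope classical_set_scope.
Local Open Scope ring_scope.

(** Points of space-time are pairs [(x, t) : 'rV[R]_n * R]. *)

(* The library's norm on ['rV[R]_n] is the sup norm; [|x|] in the mathematics
   is the Euclidean one. *)
Definition enorm (R : realType) (n : nat) (x : 'rV[R]_n) : R :=
  Num.sqrt (\sum_i x ord0 i ^+ 2).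

(* [Some i] is the i-th spatial direction, [None] the time direction. *)
Definition axis (R : realType) (n : nat) (k : option 'I_n) : 'rV[R]_n * R :=
  if k is Some i then (delta_mx ord0 i, 0) else (0, 1).

Definition partial (R : realType) (n : nat) (k : option 'I_n)
    (f : 'rV[R]_n * R -> R) : 'rV[R]_n * R -> R :=
  fun z => 'D_(axis R k) f z.

(* C1 and C2 are only used on open sets. *)
Definition C1 (R : realType) (n : nat) (S : set ('rV[R]_n * R))
    (f : 'rV[R]_n * R -> R) : Prop :=
  {within S, continuous f} /\
  forall k : option 'I_n,
    (forall z, S z -> derivable f z (axis R k)) /\
    {within S, continuous (partial k f)}.

Definition C2 (R : realType) (n : nat) (S : set ('rV[R]_n * R))
    (f : 'rV[R]_n * R -> R) : Prop :=
  C1 S f /\ forall k : option 'I_n, C1 S (partial k f).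

Definition grad_x (R : realType) (n : nat) (f : 'rV[R]_n * R -> R)
    (z : 'rV[R]_n * R) : 'rV[R]_n :=
  \row_i partial (Some i) f z.

Definition hess_x (R : realType) (n : nat) (f : 'rV[R]_n * R -> R)
    (z : 'rV[R]_n * R) : 'M[R]_n :=
  \matrix_(i, j) partial (Some j) (partial (Some i) f) z.

Definition deriv_t (R : realType) (n : nat) (f : 'rV[R]_n * R -> R)
    (z : 'rV[R]_n * R) : R :=
  partial None f z.

(* Omega x [0, T) and Omega x (0, T), where T may be +oo. *)
Definition cyl (R : realType) (n : nat) (Omega : set 'rV[R]_n) (T : \bar R) :
    set ('rV[R]_n * R) :=
  [set z | [/\ Omega z.1, 0 <= z.2 & (z.2%:E < T)%E]].

Definition open_cyl (R : realType) (n : nat) (Omega : set 'rV[R]_n)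
    (T : \bar R) : set ('rV[R]_n * R) :=
  [set z | [/\ Omega z.1, 0 < z.2 & (z.2%:E < T)%E]].

(* The right-hand side of the equation where the gradient [q] is nonzero. *)
Definition op_regular (R : realType) (n : nat) (p : R) (q : 'rV[R]_n)
    (X : 'M[R]_n) : R :=
  \sum_i \sum_j
    ((i == j)%:R + (p - 2) * (q ord0 i * q ord0 j / enorm q ^+ 2)) * X i j.

(* Its substitute, depending on a vector [a] of the closed unit ball, where the
   gradient vanishes. *)
Definition op_singular (R : realType) (n : nat) (p : R) (a : 'rV[R]_n)
    (X : 'M[R]_n) : R :=
  \sum_i \sum_j ((i == j)%:R + (p - 2) * a ord0 i * a ord0 j) * X i j.

(* The local extrema are taken at points of the open set [open_cyl Omega T], so
   neighbourhoods in the ambient space may be used. *)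
Definition viscosity_sub_ineq (R : realType) (n : nat) (p : R)
    (Omega : set 'rV[R]_n) (T : \bar R) (u : 'rV[R]_n * R -> R) : Prop :=
  forall (phi : 'rV[R]_n * R -> R) (z0 : 'rV[R]_n * R),
    C2 (open_cyl Omega T) phi ->
    open_cyl Omega T z0 ->
    (\forall z \near z0, u z - phi z <= u z0 - phi z0) ->
    (grad_x phi z0 != 0 ->
       deriv_t phi z0 <= op_regular p (grad_x phi z0) (hess_x phi z0)) /\
    (grad_x phi z0 = 0 ->
       exists a : 'rV[R]_n, enorm a <= 1 /\
         deriv_t phi z0 <= op_singular p a (hess_x phi z0)).

Definition viscosity_super_ineq (R : realType) (n : nat) (p : R)
    (Omega : set 'rV[R]_n) (T : \bar R) (u : 'rV[R]_n * R -> R) : Prop :=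
  forall (phi : 'rV[R]_n * R -> R) (z0 : 'rV[R]_n * R),
    C2 (open_cyl Omega T) phi ->
    open_cyl Omega T z0 ->
    (\forall z \near z0, u z0 - phi z0 <= u z - phi z) ->
    (grad_x phi z0 != 0 ->
       op_regular p (grad_x phi z0) (hess_x phi z0) <= deriv_t phi z0) /\
    (grad_x phi z0 = 0 ->
       exists a : 'rV[R]_n, enorm a <= 1 /\
         op_singular p a (hess_x phi z0) <= deriv_t phi z0).

(* For a function continuous on Omega x [0, T), with Omega open, membership in
   L^oo means boundedness. *)
Definition viscosity_subsolution (R : realType) (n : nat) (p : R)
    (Omega : set 'rV[R]_n) (T : \bar R) (u : 'rV[R]_n * R -> R) : Prop :=
  [/\ {within cyl Omega T, continuous u},
      [bounded u z | z in cyl Omega T] &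
      viscosity_sub_ineq p Omega T u].

Definition viscosity_supersolution (R : realType) (n : nat) (p : R)
    (Omega : set 'rV[R]_n) (T : \bar R) (u : 'rV[R]_n * R -> R) : Prop :=
  [/\ {within cyl Omega T, continuous u},
      [bounded u z | z in cyl Omega T] &
      viscosity_super_ineq p Omega T u].

Definition viscosity_solution (R : realType) (n : nat) (p : R)
    (Omega : set 'rV[R]_n) (T : \bar R) (u : 'rV[R]_n * R -> R) : Prop :=
  viscosity_subsolution p Omega T u /\ viscosity_supersolution p Omega T u.

(* Solution in Omega x [0, T] for finite T. *)
Definition viscosity_solution_closed (R : realType) (n : nat) (p : R)
    (Omega : set 'rV[R]_n) (T : R) (u : 'rV[R]_n * R -> R) : Prop :=
  exists eps : R, 0 < eps /\ viscosity_solution p Omega (T + eps)%:E u.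

(* Main.v *)
(** The barrier
      M + ep * exp ((b + be (t - t0)) |x|^2 + k (t - t0)),  b = 2 a,
    is a strict classical supersolution as long as b + be (t - t0) <= 2 b,
    provided be >= 16 (p - 1) b^2 and k > 4 b (n + |p - 2|), and it outgrows
    A exp (a |x|^2).  Hence, if u <= M at time t0, then u minus the barrier has
    no positive maximum, and letting ep tend to 0 gives u <= M on a time slab
    whose length depends only on p and a; finitely many slabs cover [0, T]. *)
Require Import Defs.
From HB Require Import structures.
From mathcomp Require Import all_boot all_order all_algebra.
From mathcomp Require Import all_classical all_reals all_analysis.
From mathcomp Require Import ring lra.

Set Implicit Arguments.
Unset Strict Implicit.
Unset Printing Implicit Defensive.

Import Order.TTheory GRing.Theory Num.Theory.
Import numFieldNormedType.Exports.

Local Open Scope classical_set_scope.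
Local Open Scope ring_scope.

(** * Directional derivatives and their calculus rules *)

(** The two difference quotients are the same function of [h]. A directional derivative thus becomes
    a one-variable derivative at 0, where the chain rule is available. *)
Lemma is_derive_lineP (R : realType) (V : normedModType R) (f : V -> R)
    (z v : V) (d : R) :
  is_derive (0 : R) (1 : R) (fun h : R => f (h *: v + z)) d <->
  is_derive z v f d.
Proof.
have E : (fun h : R => h^-1 *: (((fun h : R => f (h *: v + z)) \o shift 0)
    (h *: (1 : R)) - f (0 *: v + z))) =
  (fun h : R => h^-1 *: ((f \o shift z) (h *: v) - f z)).
  by apply: funext => h /=; rewrite scale0r add0r addr0 [h *: 1]mulr1.
by split=> -[dF DF]; split; move: dF DF; rewrite /derivable /derive E.
Qed.

Lemma is_derive_comp_line (R : realType) (V : normedModType R) (g : R -> R)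
    (f : V -> R) (z v : V) (dg df : R) :
  is_derive (f z) (1 : R) g dg -> is_derive z v f df ->
  is_derive z v (fun y => g (f y)) (dg * df).
Proof.
move=> Dg /is_derive_lineP Df; apply/is_derive_lineP.
by apply: (@is_derive1_comp _ g (fun h : R => f (h *: v + z))) => //=;
  rewrite scale0r add0r.
Qed.

Lemma is_derive_expR_comp (R : realType) (V : normedModType R)
    (f : V -> R) (z v : V) (df : R) :
  is_derive z v f df ->
  is_derive z v (fun y => expR (f y)) (expR (f z) * df).
Proof. exact: is_derive_comp_line. Qed.

Lemma is_derive_coord (R : realType) (n : nat) (i : 'I_n)
    (z v : 'rV[R]_n * R) :
  is_derive z v (fun y : 'rV[R]_n * R => y.1 ord0 i) (v.1 ord0 i).
Proof.
apply/is_derive_lineP.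
have -> : (fun h : R => (h *: v + z).1 ord0 i) =
    (fun h : R => h * v.1 ord0 i + z.1 ord0 i).
  by apply: funext => h; rewrite /= !mxE.
by apply: is_derive_eq; rewrite /GRing.scale /=; ring.
Qed.

Lemma is_derive_time (R : realType) (n : nat) (z v : 'rV[R]_n * R) :
  is_derive z v (fun y : 'rV[R]_n * R => y.2) v.2.
Proof.
apply/is_derive_lineP.
by apply: is_derive_eq; rewrite /GRing.scale /=; ring.
Qed.

(** Eta-expanded form of the sum rule, so that [apply:] can take apart an explicit [fun y => ...];
    the product rule below is restated for the same reason. *)
Lemma is_deriveD_pt (R : realType) (V : normedModType R) (f g : V -> R)
    (z v : V) (df dg : R) :
  is_derive z v f df -> is_derive z v g dg ->
  is_derive z v (fun y => f y + g y) (df + dg).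
Proof. exact: is_deriveD. Qed.

Lemma is_deriveM_pt (R : realType) (V : normedModType R) (f g : V -> R)
    (z v : V) (df dg : R) :
  is_derive z v f df -> is_derive z v g dg ->
  is_derive z v (fun y => f y * g y) (f z * dg + g z * df).
Proof. exact: is_deriveM. Qed.

(** * Smooth test functions *)

(* A class of functions stable under every [partial k]: membership yields [C2]
   without writing the second derivatives down. *)
Inductive exp_poly (R : realType) (n : nat) : ('rV[R]_n * R -> R) -> Prop :=
| exp_poly_cst c : exp_poly (fun=> c)
| exp_poly_coord i : exp_poly (fun z => z.1 ord0 i)
| exp_poly_time : exp_poly (fun z => z.2)
| exp_polyD f g : exp_poly f -> exp_poly g -> exp_poly (fun z => f z + g z)
| exp_polyM f g : exp_poly f -> exp_poly g -> exp_poly (fun z => f z * g z)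
| exp_poly_expR f : exp_poly f -> exp_poly (fun z => expR (f z)).

Lemma exp_poly_continuous (R : realType) (n : nat) (f : 'rV[R]_n * R -> R) :
  exp_poly f -> continuous f.
Proof.
elim=> [c|i||f1 g1 _ cf _ cg|f1 g1 _ cf _ cg|f1 _ cf] z.
- exact: cvg_cst.
- apply: (@continuous_comp _ _ _ (fun y : 'rV[R]_n * R => y.1)
    (fun x : 'rV[R]_n => x ord0 i)); first exact: cvg_fst.
  exact: coord_continuous.
- exact: cvg_snd.
- by apply: cvgD; [exact: cf|exact: cg].
- by apply: cvgM; [exact: cf|exact: cg].
- apply: (@continuous_comp _ _ _ f1 expR); first exact: cf.
  exact: continuous_expR.
Qed.

Lemma exp_poly_derive (R : realType) (n : nat) (f : 'rV[R]_n * R -> R)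
    (k : option 'I_n) :
  exp_poly f ->
  exists2 g, exp_poly g & forall z, is_derive z (axis R k) f (g z).
Proof.
elim=> [c|i||f1 f2 hf1 [g1 hg1 D1] hf2 [g2 hg2 D2]
  |f1 f2 hf1 [g1 hg1 D1] hf2 [g2 hg2 D2]|f1 hf1 [g1 hg1 D1]].
- by exists (fun=> 0) => [|z]; [exact: exp_poly_cst|exact: is_derive_cst].
- exists (fun=> (axis R k).1 ord0 i) => [|z]; first exact: exp_poly_cst.
  exact: is_derive_coord.
- exists (fun=> (axis R k).2) => [|z]; first exact: exp_poly_cst.
  exact: is_derive_time.
- exists (fun z => g1 z + g2 z) => [|z]; first exact: exp_polyD.
  exact: is_deriveD_pt.
- exists (fun z => f1 z * g2 z + f2 z * g1 z) => [|z].
    by apply: exp_polyD; apply: exp_polyM.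
  exact: is_deriveM_pt.
- exists (fun z => expR (f1 z) * g1 z) => [|z].
    by apply: exp_polyM => //; apply: exp_poly_expR.
  exact: is_derive_expR_comp.
Qed.

Lemma exp_poly_C1 (R : realType) (n : nat) (S : set ('rV[R]_n * R))
    (f : 'rV[R]_n * R -> R) : exp_poly f -> C1 S f.
Proof.
move=> hf; split; first exact/continuous_subspaceT/exp_poly_continuous.
move=> k; have [g hg Dg] := exp_poly_derive k hf.
split=> [z _|]; first exact: ex_derive.
have -> : partial k f = g by apply: funext => z; exact: derive_val.
exact/continuous_subspaceT/exp_poly_continuous.
Qed.

Lemma exp_poly_C2 (R : realType) (n : nat) (S : set ('rV[R]_n * R))
    (f : 'rV[R]_n * R -> R) : exp_poly f -> C2 S f.
Proof.
move=> hf; split=> [|k]; first exact: exp_poly_C1.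
have [g hg Dg] := exp_poly_derive k hf.
have -> : partial k f = g by apply: funext => z; exact: derive_val.
exact: exp_poly_C1.
Qed.

(** * The squared Euclidean norm and a trace formula *)

Definition sqnorm (R : realType) (n : nat) (x : 'rV[R]_n) : R :=
  \sum_i x ord0 i ^+ 2.

Lemma sqnorm_ge0 (R : realType) (n : nat) (x : 'rV[R]_n) : 0 <= sqnorm x.
Proof. by apply: sumr_ge0 => i _; exact: sqr_ge0. Qed.

Lemma enorm_sqr (R : realType) (n : nat) (x : 'rV[R]_n) :
  enorm x ^+ 2 = sqnorm x.
Proof. by rewrite /enorm sqr_sqrtr ?sqnorm_ge0. Qed.

Lemma sqnormZ (R : realType) (n : nat) (c : R) (x : 'rV[R]_n) :
  sqnorm (c *: x) = c ^+ 2 * sqnorm x.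
Proof.
by rewrite /sqnorm mulr_sumr; apply: eq_bigr => i _; rewrite mxE exprMn.
Qed.

Lemma sqnorm_eq0 (R : realType) (n : nat) (x : 'rV[R]_n) :
  (sqnorm x == 0) = (x == 0).
Proof.
apply/idP/eqP => [|->]; last first.
  by rewrite /sqnorm big1 // => i _; rewrite mxE expr0n.
rewrite psumr_eq0; last by move=> i _; exact: sqr_ge0.
move=> /allP x0; apply/rowP => i; rewrite mxE; apply/eqP.
by have := x0 i (mem_index_enum i); rewrite sqrf_eq0.
Qed.

Lemma exp_poly_sqnorm (R : realType) (n : nat) :
  exp_poly (fun z : 'rV[R]_n * R => sqnorm z.1).
Proof.
have -> : (fun z : 'rV[R]_n * R => sqnorm z.1) =
    (fun z => \sum_i z.1 ord0 i * z.1 ord0 i) by [].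
elim: (index_enum _) => [|i s IH].
  under eq_fun do rewrite big_nil; exact: exp_poly_cst.
under eq_fun do rewrite big_cons.
by apply: exp_polyD => //; apply: exp_polyM; exact: exp_poly_coord.
Qed.

Lemma is_derive_sqnorm (R : realType) (n : nat) (z v : 'rV[R]_n * R) :
  is_derive z v (fun y : 'rV[R]_n * R => sqnorm y.1)
    (2 * \sum_i z.1 ord0 i * v.1 ord0 i).
Proof.
have -> : (fun z : 'rV[R]_n * R => sqnorm z.1) =
    (fun z => \sum_i z.1 ord0 i * z.1 ord0 i) by [].
elim: (index_enum _) => [|i s IH].
  under eq_fun do rewrite big_nil; rewrite big_nil mulr0; exact: is_derive_cst.
under eq_fun do rewrite big_cons; rewrite big_cons mulrDr.
apply: is_deriveD_pt => //; apply: is_derive_eq.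
  by apply: is_deriveM_pt; exact: is_derive_coord.
by rewrite /=; ring.
Qed.

(** The left side is the trace of (I + k y y^T)(al x x^T + ga I). It covers both operators: [y] is
    [x] and [k] is (p - 2) / |x|^2 where the gradient is nonzero, [y] is [a] and [k] is p - 2 where
    it vanishes. *)
Lemma quadratic_trace (R : realType) (n : nat) (k al ga : R)
    (x y : 'rV[R]_n) :
  \sum_i \sum_j ((i == j)%:R + k * (y ord0 i * y ord0 j)) *
     (al * (x ord0 i * x ord0 j) + ga * (i == j)%:R) =
  al * sqnorm x + ga * n%:R +
  k * (al * (\sum_i x ord0 i * y ord0 i) ^+ 2 + ga * sqnorm y).
Proof.
have D (F : 'I_n -> 'I_n -> R) :
    \sum_i \sum_j (i == j)%:R * F i j = \sum_i F i i.
  apply: eq_bigr => i _; rewrite (bigD1 i) //= eqxx mul1r big1 ?addr0 //.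
  by move=> j ji; rewrite eq_sym (negbTE ji) mul0r.
transitivity (al * (\sum_i \sum_j (i == j)%:R * (x ord0 i * x ord0 j)) +
  ga * (\sum_(i < n) \sum_(j < n) (i == j)%:R * (i == j)%:R) +
  k * (al * (\sum_i \sum_j (x ord0 i * y ord0 i) * (x ord0 j * y ord0 j)) +
  ga * (\sum_i \sum_j (i == j)%:R * (y ord0 i * y ord0 j)))).
  rewrite mulrDr !mulrA !mulr_sumr -!big_split; apply: eq_bigr => i _ /=.
  rewrite !mulr_sumr -!big_split; apply: eq_bigr => j _ /=; ring.
rewrite !D; congr (_ + _ * _ + _ * (_ * _ + _)).
- by under eq_bigr do rewrite eqxx; rewrite sumr_const card_ord.
- by rewrite expr2 mulr_suml; apply: eq_bigr => i _; rewrite mulr_sumr.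
Qed.

(** * The barrier, its derivatives and its strict supersolution property *)

(** In the time derivative, [be] compensates the part of the operator proportional to |x|^2 and [k]
    the part that does not vanish at x = 0. *)
Definition gauss (R : realType) (n : nat) (b be k t0 : R)
    (z : 'rV[R]_n * R) : R :=
  expR ((b + be * (z.2 - t0)) * sqnorm z.1 + k * (z.2 - t0)).

(* The last term only serves to push a maximum away from the final time. *)
Definition barrier (R : realType) (n : nat) (M ep b be k t0 K m t1 : R)
    (z : 'rV[R]_n * R) : R :=
  M + ep * gauss b be k t0 z + K * expR (m * (z.2 - t1)).

Lemma is_derive_affine_time (R : realType) (n : nat) (b c t : R)
    (z v : 'rV[R]_n * R) :
  is_derive z v (fun y : 'rV[R]_n * R => b + c * (y.2 - t)) (c * v.2).
Proof.
apply: is_derive_eq.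
  apply: is_deriveD_pt.
  apply: is_deriveM_pt.
  by apply: is_deriveD_pt; exact: is_derive_time.
by rewrite /=; ring.
Qed.

Lemma is_derive_scaled_time (R : realType) (n : nat) (c t : R)
    (z v : 'rV[R]_n * R) :
  is_derive z v (fun y : 'rV[R]_n * R => c * (y.2 - t)) (c * v.2).
Proof.
have := is_derive_affine_time 0 c t z v.
by under eq_fun do rewrite add0r.
Qed.

Lemma exp_poly_barrier (R : realType) (n : nat) (M ep b be k t0 K m t1 : R) :
  exp_poly (@barrier R n M ep b be k t0 K m t1).
Proof.
rewrite /barrier /gauss.
by repeat (exact: exp_poly_cst || exact: exp_poly_time ||
  exact: exp_poly_sqnorm ||
  apply: exp_polyD || apply: exp_polyM || apply: exp_poly_expR).
Qed.

Lemma is_derive_gauss (R : realType) (n : nat) (b be k t0 : R)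
    (z v : 'rV[R]_n * R) :
  is_derive z v (gauss b be k t0)
    (gauss b be k t0 z *
      ((be * sqnorm z.1 + k) * v.2 +
       (b + be * (z.2 - t0)) * (2 * \sum_i z.1 ord0 i * v.1 ord0 i))).
Proof.
apply: is_derive_expR_comp; apply: is_derive_eq.
  apply: is_deriveD_pt; last exact: is_derive_scaled_time.
  by apply: is_deriveM_pt; [exact: is_derive_affine_time|exact: is_derive_sqnorm].
by rewrite /=; ring.
Qed.

Lemma is_derive_barrier (R : realType) (n : nat)
    (M ep b be k t0 K m t1 : R) (z v : 'rV[R]_n * R) :
  is_derive z v (barrier M ep b be k t0 K m t1)
    (ep * gauss b be k t0 z *
      ((be * sqnorm z.1 + k) * v.2 +
       (b + be * (z.2 - t0)) * (2 * \sum_i z.1 ord0 i * v.1 ord0 i)) +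
     K * m * expR (m * (z.2 - t1)) * v.2).
Proof.
apply: is_derive_eq.
  apply: is_deriveD_pt.
    apply: is_deriveD_pt.
    by apply: is_deriveM_pt; exact: is_derive_gauss.
  apply: is_deriveM_pt.
  by apply: is_derive_expR_comp; exact: is_derive_scaled_time.
by rewrite /=; ring.
Qed.

Lemma sum_mul_delta (R : realType) (n : nat) (x : 'rV[R]_n) (i : 'I_n) :
  \sum_j x ord0 j * (delta_mx ord0 i : 'rV[R]_n) ord0 j = x ord0 i.
Proof.
rewrite (bigD1 i) //= mxE !eqxx mulr1 big1 ?addr0 // => j ji.
by rewrite mxE (negbTE ji) andbF mulr0.
Qed.

Lemma deriv_t_barrier (R : realType) (n : nat)
    (M ep b be k t0 K m t1 : R) (z : 'rV[R]_n * R) :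
  deriv_t (barrier M ep b be k t0 K m t1) z =
  ep * gauss b be k t0 z * (be * sqnorm z.1 + k) +
    K * m * expR (m * (z.2 - t1)).
Proof.
rewrite /deriv_t /partial.
have -> := @derive_val _ _ _ _ _ _ _
  (is_derive_barrier M ep b be k t0 K m t1 z (axis R None)).
rewrite /= big1; first by ring.
by move=> i _; rewrite mxE mulr0.
Qed.

(** An equality of functions, not of values, because the Hessian differentiates it once more. *)
Lemma partial_barrier (R : realType) (n : nat)
    (M ep b be k t0 K m t1 : R) (i : 'I_n) :
  partial (Some i) (barrier M ep b be k t0 K m t1) =
  (fun z => ep * gauss b be k t0 z *
     ((2 * b + 2 * be * (z.2 - t0)) * z.1 ord0 i)).
Proof.
apply: funext => z; rewrite /partial.
have -> := @derive_val _ _ _ _ _ _ _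
  (is_derive_barrier M ep b be k t0 K m t1 z (axis R (Some i))).
by rewrite /= sum_mul_delta; ring.
Qed.

Lemma grad_barrier (R : realType) (n : nat)
    (M ep b be k t0 K m t1 : R) (z : 'rV[R]_n * R) :
  grad_x (barrier M ep b be k t0 K m t1) z =
  (ep * gauss b be k t0 z * (2 * (b + be * (z.2 - t0)))) *: z.1.
Proof. by apply/rowP => i; rewrite !mxE partial_barrier; ring. Qed.

Lemma hess_barrier (R : realType) (n : nat)
    (M ep b be k t0 K m t1 : R) (z : 'rV[R]_n * R) (i j : 'I_n) :
  hess_x (barrier M ep b be k t0 K m t1) z i j =
  ep * gauss b be k t0 z * (2 * (b + be * (z.2 - t0))) ^+ 2 *
    (z.1 ord0 i * z.1 ord0 j) +
  ep * gauss b be k t0 z * (2 * (b + be * (z.2 - t0))) * (i == j)%:R.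
Proof.
rewrite mxE partial_barrier {1}/partial; apply: derive_val.
apply: is_derive_eq.
  apply: is_deriveM_pt.
    by apply: is_deriveM_pt; exact: is_derive_gauss.
  by apply: is_deriveM_pt; [exact: is_derive_affine_time|exact: is_derive_coord].
by rewrite /= sum_mul_delta mxE eqxx /=; ring.
Qed.

(** With G and B as set in the proof, the operator applied to the barrier is G (4 (p - 1) B^2 |x|^2
    + 2 B (n + p - 2)) for x nonzero and at most 2 G B (n + |p - 2|) at x = 0. The time derivative
    is at least G (be |x|^2 + k), which is strictly larger, so the subsolution inequality fails. *)
Lemma barrier_no_contact (R : realType) (n : nat) (p : R)
    (Omega : set 'rV[R]_n) (T : \bar R) (u : 'rV[R]_n * R -> R)
    (M ep b be k t0 K m t1 : R) (z : 'rV[R]_n * R) :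
  1 < p -> viscosity_sub_ineq p Omega T u ->
  0 < ep -> 0 < b -> 0 <= be -> 0 <= K -> 0 <= m ->
  16 * (p - 1) * b ^+ 2 <= be -> 4 * b * (n%:R + `|p - 2|) < k ->
  t0 <= z.2 -> be * (z.2 - t0) <= b -> open_cyl Omega T z ->
  ~ (\forall y \near z, u y - barrier M ep b be k t0 K m t1 y <=
       u z - barrier M ep b be k t0 K m t1 z).
Proof.
move=> p1 usub ep0 b0 be0 K0 m0 hbe hk t0z hz Oz zmax.
have [] := usub _ z (exp_poly_C2 _ (exp_poly_barrier _ _ _ _ _ _ _ _ _ _))
  Oz zmax.
rewrite grad_barrier deriv_t_barrier.
set G := ep * gauss b be k t0 z.
have G0 : 0 < G by rewrite mulr_gt0 // expR_gt0.
set B := b + be * (z.2 - t0).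
have Bb : b <= B by rewrite lerDl mulr_ge0 // subr_ge0.
have B2b : B <= 2 * b by rewrite /B; lra.
have B0 : 0 < B by lra.
set P := K * m * expR (m * (z.2 - t1)).
have P0 : 0 <= P by rewrite mulr_ge0 ?mulr_ge0 // ltW // expR_gt0.
set r := sqnorm z.1.
have r0 : 0 <= r := sqnorm_ge0 _.
(* B <= 2 b costs a factor 4, which with the 4 of the operator gives the 16 in the hypothesis on
   [be]. *)
have BB : B ^+ 2 <= 4 * b ^+ 2 by nra.
have pB : 4 * (p - 1) * B ^+ 2 <= be by nra.
have pBr : 4 * (p - 1) * B ^+ 2 * r <= be * r by rewrite ler_wpM2r.
(* One bound for both cases: s = |a|^2 at the origin, s = 1 elsewhere. *)
have kB s : 0 <= s <= 1 -> 2 * B * (n%:R + (p - 2) * s) < k.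
  move=> /andP[s0 s1]; apply: le_lt_trans hk.
  have n0 : 0 <= n%:R :> R by [].
  have h1 : (p - 2) * s <= `|p - 2|.
    apply: le_trans (ler_norm _) _.
    by rewrite normrM (ger0_norm s0) ler_piMr.
  have h2 := normr_ge0 (p - 2).
  apply: le_trans (_ : 2 * B * (n%:R + `|p - 2|) <= _).
    by rewrite ler_wpM2l ?lerD2l //; lra.
  by rewrite ler_wpM2r ?addr_ge0 //; lra.
(* The gradient is a positive multiple of x, so it vanishes exactly at x = 0. *)
have [x0|xN0] := eqVneq z.1 0.
- move=> _ []; first by rewrite x0 scaler0.
  move=> a [a1]; apply/negP; rewrite -ltNge /op_singular.
  have -> : \sum_i \sum_j ((i == j)%:R + (p - 2) * a ord0 i * a ord0 j) *
      hess_x (barrier M ep b be k t0 K m t1) z i j =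
    \sum_i \sum_j ((i == j)%:R + (p - 2) * (a ord0 i * a ord0 j)) *
      (G * (2 * B) ^+ 2 * (z.1 ord0 i * z.1 ord0 j) +
       G * (2 * B) * (i == j)%:R).
    apply: eq_bigr => i _; apply: eq_bigr => j _.
    by rewrite hess_barrier -/G -/B; ring.
  rewrite quadratic_trace big1; last by move=> i _; rewrite x0 mxE mul0r.
  have r00 : sqnorm z.1 = 0 by apply/eqP; rewrite sqnorm_eq0 x0.
  rewrite /r r00.
  have /kB h : 0 <= sqnorm a <= 1.
    rewrite sqnorm_ge0 -enorm_sqr -[X in _ <= X](expr1n R 2).
    by rewrite lerXn2r // ?nnegrE ?sqrtr_ge0.
  have : G * (2 * B * (n%:R + (p - 2) * sqnorm a)) < G * k by rewrite ltr_pM2l.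
  lra.
- have rN0 : r != 0 by rewrite sqnorm_eq0.
  have c0 : 0 < G * (2 * B) by rewrite mulr_gt0 // mulr_gt0.
  have cx0 : (G * (2 * B)) *: z.1 != 0 by rewrite scaler_eq0 negb_or xN0 gt_eqF.
  move=> /(_ cx0) + _.
  apply/negP; rewrite -ltNge /op_regular.
  (* The positive factor cancels in the normalised gradient, leaving x x^T / |x|^2. *)
  have -> : \sum_i \sum_j ((i == j)%:R + (p - 2) *
      (((G * (2 * B)) *: z.1) ord0 i * ((G * (2 * B)) *: z.1) ord0 j /
        enorm ((G * (2 * B)) *: z.1) ^+ 2)) *
      hess_x (barrier M ep b be k t0 K m t1) z i j =
    \sum_i \sum_j ((i == j)%:R + (p - 2) / r * (z.1 ord0 i * z.1 ord0 j)) *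
      (G * (2 * B) ^+ 2 * (z.1 ord0 i * z.1 ord0 j) +
       G * (2 * B) * (i == j)%:R).
    apply: eq_bigr => i _; apply: eq_bigr => j _; rewrite hess_barrier.
    congr (_ * _); rewrite enorm_sqr sqnormZ !mxE -/r.
    by field; rewrite rN0 !gt_eqF.
  rewrite quadratic_trace -/r.
  have -> : \sum_i z.1 ord0 i * z.1 ord0 i = r by [].
  have h : 4 * (p - 1) * B ^+ 2 * r + 2 * B * (n%:R + (p - 2) * 1) < be * r + k.
    by apply: ler_ltD => //; apply: kB; rewrite ler01 lexx.
  have : G * (4 * (p - 1) * B ^+ 2 * r + 2 * B * (n%:R + (p - 2) * 1)) <
    G * (be * r + k) by rewrite ltr_pM2l.
  suff -> : G * (2 * B) ^+ 2 * r + G * (2 * B) * n%:R +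
    (p - 2) / r * (G * (2 * B) ^+ 2 * r ^+ 2 + G * (2 * B) * r) =
    G * (4 * (p - 1) * B ^+ 2 * r + 2 * B * (n%:R + (p - 2) * 1)) by lra.
  by field.
Qed.

(** * Cubes, and domination of the growth bound by the barrier *)

(** Balls of the sup norm are open cubes; they serve as the bounded domains, and closed cubes as the
    compact sets. *)
Lemma cube_ballP (R : realType) (n : nat) (r : R) (x : 'rV[R]_n) :
  0 < r -> ball (0 : 'rV[R]_n) r x <-> forall i, `|x ord0 i| < r.
Proof.
move=> r0; split=> [[_ h] i|h].
  by have := h ord0 i; rewrite /ball /= mxE sub0r normrN.
by split=> // i j; rewrite /ball /= mxE sub0r normrN ord1.
Qed.

Lemma bounded_set_ball (R : realType) (n : nat) (r : R) :
  bounded_set (ball (0 : 'rV[R]_n) r).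
Proof.
exists r; split; first exact: num_real.
move=> s rs x; rewrite mx_norm_ball /ball_ /= sub0r normrN => xr.
exact: ltW (lt_trans xr rs).
Qed.

Lemma compact_cube (R : realType) (n : nat) (r : R) :
  compact [set x : 'rV[R]_n | forall i, `|x ord0 i| <= r].
Proof.
have -> : [set x : 'rV[R]_n | forall i, `|x ord0 i| <= r] =
    [set x | forall i, `[- r, r]%classic (x ord0 i)].
  apply/seteqP; split=> x h i; have := h i; rewrite /= in_itv /= ler_norml //.
apply: (@rV_compact R n (fun=> `[- r, r]%classic)) => i.
exact: segment_compact.
Qed.

Lemma sqr_coord_le_sqnorm (R : realType) (n : nat) (x : 'rV[R]_n) (i : 'I_n) :
  x ord0 i ^+ 2 <= sqnorm x.
Proof.
rewrite /sqnorm (bigD1 i) //= lerDl.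
by apply: sumr_ge0 => j _; exact: sqr_ge0.
Qed.

Lemma gauss_ge (R : realType) (n : nat) (b be k t0 : R) (z : 'rV[R]_n * R) :
  0 <= be -> 0 <= k -> t0 <= z.2 ->
  expR (b * sqnorm z.1) <= gauss b be k t0 z.
Proof.
move=> be0 k0 hz; rewrite ler_expR.
have h1 : 0 <= be * (z.2 - t0) by rewrite mulr_ge0 ?subr_ge0.
have h2 : 0 <= k * (z.2 - t0) by rewrite mulr_ge0 ?subr_ge0.
have := mulr_ge0 h1 (sqnorm_ge0 z.1); lra.
Qed.

Lemma barrier_ge (R : realType) (n : nat) (M ep b be k t0 K m t1 : R)
    (z : 'rV[R]_n * R) :
  0 <= ep -> 0 <= K -> M <= barrier M ep b be k t0 K m t1 z.
Proof.
move=> ep0 K0; have := mulr_ge0 ep0 (expR_ge0 _ : 0 <= gauss b be k t0 z).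
by have := mulr_ge0 K0 (expR_ge0 (m * (z.2 - t1))); rewrite /barrier; lra.
Qed.

(** Put y = exp(a |x|^2). Then y >= 1 + a |x|^2 gives ep y >= A + |M|, while the Gaussian is at
    least y^2. Hence ep y^2 >= (A + |M|) y >= A y + |M|, so A y <= M + ep y^2. *)
Lemma growth_le_barrier (R : realType) (n : nat)
    (A a M ep be k t0 K m t1 r : R) (z : 'rV[R]_n * R) (v : R) :
  0 < A -> 0 < a -> 0 < ep -> 0 <= be -> 0 <= k -> 0 <= K -> t0 <= z.2 ->
  A + `|M| <= ep * (a * r) -> r <= sqnorm z.1 ->
  v <= A * expR (a * sqnorm z.1) ->
  v <= barrier M ep (2 * a) be k t0 K m t1 z.
Proof.
move=> A0 a0 ep0 be0 k0 K0 hz hr hrz /le_trans; apply.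
have := gauss_ge (2 * a) be0 k0 hz.
rewrite (_ : 2 * a * sqnorm z.1 = a * sqnorm z.1 + a * sqnorm z.1); last by ring.
rewrite expRD; set y := expR (a * sqnorm z.1) => hg.
have hy : 1 + a * sqnorm z.1 <= y by exact: expR_ge1Dx.
have ar : a * r <= a * sqnorm z.1 by rewrite ler_pM2l.
have s0 : 0 <= a * sqnorm z.1 by rewrite mulr_ge0 ?sqnorm_ge0 // ltW.
have y1 : 1 <= y by lra.
have epy : A + `|M| <= ep * y.
  by apply: le_trans hr _; rewrite ler_pM2l //; lra.
have M0 : 0 <= `|M| := normr_ge0 _.
have h1 : (A + `|M|) * y <= ep * y * y by rewrite ler_wpM2r //; lra.
have h2 : `|M| * 1 <= `|M| * y by rewrite ler_wpM2l.
have h3 : ep * (y * y) <= ep * gauss (2 * a) be k t0 z by rewrite ler_pM2l.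
have h4 := mulr_ge0 K0 (expR_ge0 (m * (z.2 - t1))).
have := ler_norm (- M); rewrite normrN /barrier; lra.
Qed.

(** From exp(s) >= 1 + s at s = K / d: K <= d + K = d (1 + K / d). *)
Lemma mul_expRN_le (R : realType) (K d : R) :
  0 <= K -> 0 < d -> K * expR (- (K / d)) <= d.
Proof.
move=> K0 d0; rewrite expRN ler_pdivrMr ?expR_gt0 //.
apply: le_trans (_ : d * (1 + K / d) <= _); last first.
  by rewrite ler_pM2l // expR_ge1Dx.
by rewrite mulrDr mulrCA divff ?gt_eqF // !mulr1 lerDr ltW.
Qed.

(** * The maximum principle on a short time slab *)

(** If u(x, t) > M, then u minus a suitable barrier has a positive maximum over a closed cube times
    [t0, t1]. The bound at [t0], the growth bound on the lateral faces and the [K] term at [t1]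
    force it into the interior, against [barrier_no_contact]. *)
Lemma slab_max_principle (R : realType) (n : nat) (p : R)
    (u : 'rV[R]_n * R -> R) (A a M t0 t : R) (x : 'rV[R]_n) :
  1 < p ->
  {within [set z : 'rV[R]_n * R | 0 <= z.2], continuous u} ->
  (forall (Omega : set 'rV[R]_n) (T : R),
     open Omega -> bounded_set Omega -> 0 < T ->
     viscosity_solution_closed p Omega T u) ->
  0 < A -> 0 < a ->
  (forall (y : 'rV[R]_n) (s : R), 0 <= s ->
     u (y, s) <= A * expR (a * enorm y ^+ 2)) ->
  0 <= t0 -> (forall y, u (y, t0) <= M) ->
  t0 <= t -> 32 * (p - 1) * a * (t - t0) < 1 -> u (x, t) <= M.
Proof.
move=> p1 ucont usol A0 a0 ugrowth t00 uM t0t ht.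
rewrite leNgt; apply/negP => ultM.
set d := u (x, t) - M; have d0 : 0 < d by rewrite subr_gt0.
pose b := 2 * a; have b0 : 0 < b by rewrite /b; lra.
pose be := 16 * (p - 1) * b ^+ 2.
have be0 : 0 < be by rewrite /be !mulr_gt0 ?subr_gt0 // exprn_gt0.
(* The time at which the coefficient of |x|^2 has doubled from b to 2 b. Since be / b = 32 (p - 1)
   a, the hypothesis on [t] says exactly t < t1. *)
pose t1 := t0 + b / be.
have bt1 : be * (t1 - t0) = b by rewrite /t1; field; rewrite gt_eqF.
have tt1 : t < t1.
  rewrite -ltrBlDl ltr_pdivlMr //.
  have -> : (t - t0) * be = 32 * (p - 1) * a * (t - t0) * b.
    by rewrite /be /b; ring.
  by rewrite -[X in _ < X]mul1r ltr_pM2r.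
pose k := 4 * b * (n%:R + `|p - 2|) + 1.
have nk : 0 <= 4 * b * (n%:R + `|p - 2|).
  by rewrite mulr_ge0 ?addr_ge0 //; lra.
have k0 : 0 <= k by rewrite /k; lra.
(* The Gaussian term and the [K] term each take d / 4 at (x, t), so u - phi is at least d / 2
   there. *)
pose ep := d / 4 / gauss b be k t0 (x, t).
have ep0 : 0 < ep by rewrite !divr_gt0 // expR_gt0.
(* The first two summands put x in the cube, the last makes the barrier dominate the growth bound
   once |y|^2 >= r. *)
pose r := 1 + sqnorm x + (A + `|M|) / (ep * a).
have AM0 : 0 < A + `|M| by rewrite ltr_pwDl.
have AMr : 0 < (A + `|M|) / (ep * a) by rewrite divr_gt0 // mulr_gt0.
have sx0 := sqnorm_ge0 x.
have r1 : 1 <= r by rewrite /r; lra.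
have hr : A + `|M| <= ep * (a * r).
  have -> : A + `|M| = ep * a * ((A + `|M|) / (ep * a)).
    by field; rewrite !gt_eqF.
  by rewrite (mulrA ep) ler_pM2l ?(mulr_gt0 ep0 a0) // /r; lra.
have xr i : `|x ord0 i| <= r.
  have := sqr_coord_le_sqnorm x i; rewrite -real_normK ?num_real // => h.
  by rewrite /r; nra.
(* |y|^2 <= n r^2 on the cube, so K bounds u - M there; at time [t1] the last term of the barrier
   equals K. *)
pose K := A * expR (a * (n%:R * r ^+ 2)) + `|M|.
have K0 : 0 <= K by rewrite addr_ge0 // mulr_ge0 ?expR_ge0 // ltW.
(* Chosen so that m (t - t1) = - K / (d / 4), as [mul_expRN_le] requires. *)
pose m := K / (d / 4) / (t1 - t).
have m0 : 0 <= m by rewrite !divr_ge0 //; lra.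
pose phi := barrier M ep b be k t0 K m t1 : 'rV[R]_n * R -> R.
have uphi : 0 < u (x, t) - phi (x, t).
  have h1 : ep * gauss b be k t0 (x, t) = d / 4.
    by rewrite /ep divfK // gt_eqF // expR_gt0.
  have h2 : K * expR (m * (t - t1)) <= d / 4.
    rewrite (_ : m * (t - t1) = - (K / (d / 4))).
      by apply: mul_expRN_le => //; lra.
    by rewrite /m; field; rewrite !gt_eqF //; lra.
  by rewrite /phi /barrier h1 /= /d in h2 *; lra.
pose S : set ('rV[R]_n * R) :=
  [set y : 'rV[R]_n | forall i, `|y ord0 i| <= r] `*` `[t0, t1]%classic.
have Sx : S (x, t) by split=> //=; rewrite in_itv /= t0t ltW.
have cS : compact S by apply: compact_setX; [exact: compact_cube|exact: segment_compact].
have cf : {within S, continuous (fun z => u z - phi z)}.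
  have cu : {within S, continuous u}.
    apply: continuous_subspaceW ucont => z [_] /=; rewrite in_itv /= => /andP[+ _].
    exact: le_trans.
  have cp : {within S, continuous phi}.
    apply: continuous_subspaceT; apply: exp_poly_continuous.
    exact: exp_poly_barrier.
  by move=> z; apply: cvgB; [exact: cu|exact: cp].
have [c] := compact_EVT_max (ex_intro _ _ Sx) cS cf.
rewrite inE => -[/= cr]; rewrite in_itv /= => /andP[t0c ct1] cmax.
have ucphi : phi c < u c.
  rewrite -subr_gt0; apply: lt_le_trans uphi (cmax _ _); exact/mem_set.
have t0c' : t0 < c.2.
  rewrite lt_neqAle t0c andbT; apply/eqP => e.
  have := uM c.1; rewrite e -surjective_pairing leNgt => /negP; apply.
  exact: le_lt_trans (barrier_ge _ _ _ _ _ _ _ _ (ltW ep0) K0) ucphi.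
have c20 : 0 <= c.2 by exact: le_trans t00 t0c.
have uc : u c <= A * expR (a * sqnorm c.1).
  by rewrite -enorm_sqr {1}[c]surjective_pairing; exact: ugrowth.
have ct1' : c.2 < t1.
  rewrite lt_neqAle ct1 andbT; apply/eqP => e.
  have sc : sqnorm c.1 <= n%:R * r ^+ 2.
    rewrite mulr_natl -[n in _ *+ n]card_ord -sumr_const.
    apply: ler_sum => i _; rewrite -real_normK ?num_real //.
    by rewrite lerXn2r // nnegrE; lra.
  have : A * expR (a * sqnorm c.1) <= A * expR (a * (n%:R * r ^+ 2)).
    by rewrite ler_pM2l // ler_expR ler_pM2l.
  have := mulr_ge0 (ltW ep0) (expR_ge0 _ : 0 <= gauss b be k t0 c).
  have := ler_norm (- M); rewrite normrN.
  move: ucphi; rewrite /phi /barrier e subrr mulr0 expR0 mulr1 /K; lra.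
have cr' i : `|c.1 ord0 i| < r.
  rewrite ltNge; apply/negP => hc.
  (* A coordinate of size at least r gives |c|^2 >= r^2 >= r, because r >= 1. *)
  have rc : r <= sqnorm c.1.
    apply: le_trans (sqr_coord_le_sqnorm c.1 i).
    by rewrite -real_normK ?num_real //; nra.
  have := growth_le_barrier m t1 A0 a0 ep0 (ltW be0) k0 K0 t0c hr rc uc.
  by rewrite leNgt ucphi.
have t10 : 0 < t1 by lra.
have r0 : 0 < r by lra.
have ballP (y : 'rV[R]_n) := cube_ballP y r0.
have [e [e0 [[_ _ usub] _]]] := usol (ball (0 : 'rV[R]_n) r) t1
  (ball_open 0 r) (@bounded_set_ball R n r) t10.
apply: (@barrier_no_contact R n p _ _ u M ep b be k t0 K m t1 c) => //.
- exact: usub.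
- exact: ltW.
- by rewrite /k ltrDl.
- by rewrite -bt1 ler_pM2l //; lra.
- by split; [apply/ballP|exact: le_lt_trans t00 t0c'|rewrite lte_fin; lra].
(* The maximum over the compact set is a local one in the ambient space, as the interior of that set
   is a neighbourhood of [c]. *)
have : nbhs c (ball (0 : 'rV[R]_n) r `*` `]t0, t1[%classic).
  exists (ball (0 : 'rV[R]_n) r, `]t0, t1[%classic) => //; split.
    by apply: open_nbhs_nbhs; split; [exact: ball_open|apply/ballP].
  apply: open_nbhs_nbhs; split; first exact: interval_open.
  by rewrite /= in_itv /= t0c' ct1'.
apply: filterS => y [/ballP yr]; rewrite /= in_itv /= => /andP[y0 y1].
apply: cmax; apply/mem_set; split=> /= [i|]; first exact: ltW (yr i).
by rewrite in_itv /= !ltW.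
Qed.

(** * Iteration over time slabs and the equality of suprema *)

(** Induction on the number of slabs of length 1 / (64 (p - 1) a). This is half the length at which
    the slab principle stops, which secures its strict inequality. *)
Lemma global_max_principle (R : realType) (n : nat) (p : R)
    (u : 'rV[R]_n * R -> R) (A a M t : R) (x : 'rV[R]_n) :
  1 < p ->
  {within [set z : 'rV[R]_n * R | 0 <= z.2], continuous u} ->
  (forall (Omega : set 'rV[R]_n) (T : R),
     open Omega -> bounded_set Omega -> 0 < T ->
     viscosity_solution_closed p Omega T u) ->
  0 < A -> 0 < a ->
  (forall (y : 'rV[R]_n) (s : R), 0 <= s ->
     u (y, s) <= A * expR (a * enorm y ^+ 2)) ->
  (forall y, u (y, 0) <= M) -> 0 <= t -> u (x, t) <= M.
Proof.
move=> p1 ucont usol A0 a0 ugrowth uM t_ge0.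
have c0 : 0 < 64 * (p - 1) * a by rewrite !mulr_gt0 ?subr_gt0.
suff main N : forall y s, 0 <= s -> 64 * (p - 1) * a * s <= N%:R -> u (y, s) <= M.
  by apply: main t_ge0 (ltW (truncnS_gt _)).
elim: N => [y s s0|N IH y s s0 sN].
  rewrite pmulr_rle0 // => s_le0.
  by rewrite (@le_anti _ _ s 0) ?s0 ?s_le0.
have [|Ns] := leP (64 * (p - 1) * a * s) N%:R; first exact: IH.
(* The end of the N-th slab, where the induction hypothesis supplies the new initial bound. *)
pose s1 := N%:R / (64 * (p - 1) * a).
have s1E : 64 * (p - 1) * a * s1 = N%:R.
  by rewrite /s1 mulrC divfK // gt_eqF.
have s1_ge0 : 0 <= s1 by rewrite divr_ge0 // ltW.
have s1s : s1 <= s by rewrite -(ler_pM2l c0) s1E ltW.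
apply: (@slab_max_principle R n p u A a M s1 s y) => //.
  by move=> y'; apply: IH => //; rewrite s1E.
by move: sN; rewrite -(natr1 N) -s1E; lra.
Qed.

Theorem theorem4p2 (R : realType) (n : nat) (n_gt0 : (0 < n)%N) (p : R)
    (p_gt1 : 1 < p) (u : 'rV[R]_n * R -> R)
    (u_cont : {within [set z : 'rV[R]_n * R | 0 <= z.2], continuous u})
    (u_sol : forall (Omega : set 'rV[R]_n) (T : R),
       open Omega -> bounded_set Omega -> 0 < T ->
       viscosity_solution_closed p Omega T u)
    (A a : R) (A_gt0 : 0 < A) (a_gt0 : 0 < a)
    (u_growth : forall (x : 'rV[R]_n) (t : R), 0 <= t ->
       u (x, t) <= A * expR (a * enorm x ^+ 2))
    (T : R) (T_gt0 : 0 < T) :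
  ereal_sup [set (u z)%:E | z in [set z : 'rV[R]_n * R | 0 <= z.2 <= T]] =
  ereal_sup [set (u (x, 0))%:E | x in [set: 'rV[R]_n]].

Proof.
apply/le_anti/andP; split; last first.
  apply: ereal_sup_le => _ [x _ <-]; exists (x, 0) => //=.
  by rewrite lexx ltW.
apply: ge_ereal_sup => _ [[x t] /= /andP[t0 _] <-].
have ub y : ((u (y, 0))%:E <=
    ereal_sup [set (u (x, 0))%:E | x in [set: 'rV[R]_n]])%E.
  by apply: ereal_sup_ubound; exists y.
(* A finite supremum is the case of the maximum principle, +oo is trivial, and -oo is excluded by
   the value at x = 0. *)
move: ub; case: (ereal_sup _) => [M||] ub.
- rewrite lee_fin.
  exact: (global_max_principle x p_gt1 u_cont u_sol A_gt0 a_gt0 u_growth).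
- exact: leey.
- by have := ub 0; rewrite leNgt ltNyr.
Qed.
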